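(* Let $(\mathbf P_t)_{t\ge0}$ be a $\mu$-symmetric semigroup which is $\tau$-Orlicz hyperbounded: for some $t_0>0$, $\mathbf P_{t_0}$ maps $L^2(\mu)$ continuously into $(L_\tau(\mu),N_\tau)$ with operator norm $C(t_0,\tau)$. Assume that the function $$y\mapsto y^2\log\left(\frac{(\tau^* )^{-1}(y^2\tau^*(1))}{|y|}\right)$$ can be continuously extended up to the origin, where $(\tau^* )^{-1}$ is the inverse function of $\tau^*$ on $\mathbb R^+$. Then for all (non-zero) $f\in\mathbb D$ the following defective logarithmic Orlicz-Sobolev inequality holds: $$\mathbf{Ent}_\tau(f)\le a\,\mathcal E(f,f)+b\,\|f\|_2^2,\qquad a=\frac{t_0}{2},\quad b=\log\big(C(t_0,\tau)\big),$$ where $$\mathbf{Ent}_\tau(f):=\int f^2\log\left(\frac{(\tau^* )^{-1}\big(\tau^*(1)(f/\|f\|_2)^2\big)}{|f/\|f\|_2|}\right)d\mu .$$ In particular, if $(\mathbf P_t)_{t\ge0}$ is $\tau$-Orlicz hypercontractive (that is, for some $t_0>0$, $\mathbf P_{t_0}$ is a contraction from $L^2(\mu)$ into $(L_\tau(\mu),N_\tau)$), the inequality is tight: $\mathbf{Ent}_\tau(f)\le a\,\mathcal E(f,f)$ for all $f\in\mathbb D$.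
   Context: $\mu$ is a probability measure and $(\mathbf P_t)_{t\ge0}$ is a $\mu$-symmetric Markov diffusion semigroup with generator $\mathbf L$ (in particular $\mathbf P_t 1=1$). $\mathcal E$ is the associated Dirichlet form with the normalization $\mathcal E(f,f)=-2\int f\,\mathbf Lf\,d\mu$, so that $\mathcal E(f,f)=\int|\nabla f|^2d\mu$ when $d\mu=e^{-2V}dx$ on $\mathbb R^n$ and $\mathbf L=\frac12\Delta-\nabla V\cdot\nabla$. $\mathbb D$ is a core algebra of bounded functions in the domain of $\mathbf L$ (in the usual $\mathbb R^n$ case, the smooth compactly supported functions plus constants). $\|\cdot\|_2$ is the $L^2(\mu)$ norm. $(\tau^*,\tau)$ is a complementary pair of continuous even Young functions ($\tau^*$ is the Legendre-Fenchel dual of $\tau$; both are convex and vanish at the origin), smooth and increasing on $\mathbb R^+$, such that $\tau(y)/y^2\to+\infty$ and $\tau(y)/y^p\to0$ for every $p>2$ as $y\to+\infty$. Both satisfy the $\Delta_2$ condition (there are $K>1$, $y_1\ge0$ with $\tau(2y)\le K\tau(y)$ for $y\ge y_1$, and similarly for $\tau^*$), and they are normalized by $\tau(1)+\tau^*(1)=1$. $L_\tau(\mu)$ is the space of measurable $f$ with $\int\tau(f)\,d\mu<\infty$, with gauge norm $N_\tau(f)=\inf\{k>0:\ \int\tau(f/k)\,d\mu\le\tau(1)\}$. The integrand in $\mathbf{Ent}_\tau$ is understood through the continuous extension at the points where $f=0$. *)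

(* Defs.v *)
From HB Require Import structures.
From mathcomp Require Import all_boot all_order all_algebra.
From mathcomp Require Import all_classical all_reals all_analysis.
Set Implicit Arguments.
Unset Strict Implicit.
Unset Printing Implicit Defensive.
Import Order.TTheory GRing.Theory Num.Theory.
Import numFieldNormedType.Exports.
Local Open Scope classical_set_scope.
Local Open Scope ring_scope.

Definition smooth_on (R : realType) (A : set R) (f : R -> R) : Prop :=
  forall (n : nat) (x : R), A x -> derivable (f^`(n)%classic) x 1.

Definition Delta2 (R : realType) (tau : R -> R) : Prop :=
  exists K y1 : R,
    [/\ 1 < K, 0 <= y1 & forall y, y1 <= y -> tau (2 * y) <= K * tau y].

(* Smoothness is required on the open half-line only, so that even functions
   such as |y|^p are covered; there is no condition on the derivatives at 0. *)
Record young_function (R : realType) (tau : R -> R) : Prop := YoungFunction {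
  young_continuous : continuous tau ;
  young_even : forall y, tau (- y) = tau y ;
  young_convex : convex_function (setT : set R) tau ;
  young0 : tau 0 = 0 ;
  young_smooth : smooth_on `]0, +oo[%classic tau ;
  young_increasing : {in `[0, +oo[ &, {homo tau : x y / x < y}} }.

Record young_pair (R : realType) (tau taus : R -> R) : Prop := YoungPair {
  young_pair_l : young_function tau ;
  young_pair_r : young_function taus ;
  young_pair_dual : forall y,
    (taus y)%:E = ereal_sup (range (fun x : R => (x * y - tau x)%:E)) ;
  young_pair_growth : (fun y : R => tau y / y ^+ 2) @ +oo --> +oo ;
  young_pair_subpower : forall p : R, 2 < p ->
    (fun y : R => tau y / y `^ p) @ +oo --> (0 : R) ;
  young_pair_Delta2l : Delta2 tau ;
  young_pair_Delta2r : Delta2 taus ;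
  young_pair_normalized : tau 1 + taus 1 = 1 }.

Definition inv_nneg (R : realType) (taus : R -> R) : R -> R :=
  'pinv_(fun=> 0) `[0, +oo[%classic taus.

Definition extend0 (R : realType) (g : R -> R) (y : R) : R :=
  if y == 0 then lim (g @ 0^') else g y.

Section orlicz_semigroup.
Context {d : measure_display} {T : measurableType d} {R : realType}.
Variable mu : probability T R.

Definition L2norm (f : T -> R) : R := fine 'N[mu]_2%:E[EFin \o f].

Definition Lorlicz (tau : R -> R) : set (T -> R) :=
  [set f | measurable_fun setT f /\ (\int[mu]_x (tau (f x))%:E < +oo)%E].

(* The gauge is extended-real valued: it is +oo when no k is admissible. *)
Definition gauge (tau : R -> R) (f : T -> R) : \bar R :=
  ereal_inf [set k%:E | k in
    [set k : R | 0 < k /\ (\int[mu]_x (tau (f x / k))%:E <= (tau 1)%:E)%E]].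

(* P t acts on representatives: it is only meaningful on square integrable
   functions, for t >= 0, and up to mu-a.e. equality. *)
Variable P : R -> (T -> R) -> T -> R.

Record symmetric_markov_semigroup : Prop := SymmetricMarkovSemigroup {
  semigroup_Lfun : forall t f, 0 <= t ->
    f \in Lfun mu 2%:E -> P t f \in Lfun mu 2%:E ;
  semigroup_ae_eq : forall t f g, 0 <= t ->
    f \in Lfun mu 2%:E -> g \in Lfun mu 2%:E ->
    {ae mu, forall x, f x = g x} -> {ae mu, forall x, P t f x = P t g x} ;
  semigroup_linear : forall t a f g, 0 <= t ->
    f \in Lfun mu 2%:E -> g \in Lfun mu 2%:E ->
    {ae mu, forall x, P t (fun y => a * f y + g y) x = a * P t f x + P t g x} ;
  semigroup_contraction : forall t f, 0 <= t ->
    f \in Lfun mu 2%:E -> L2norm (P t f) <= L2norm f ;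
  semigroup_positive : forall t f, 0 <= t -> f \in Lfun mu 2%:E ->
    {ae mu, forall x, 0 <= f x} -> {ae mu, forall x, 0 <= P t f x} ;
  semigroup_one : forall t, 0 <= t -> {ae mu, forall x, P t (cst 1) x = 1} ;
  semigroup_symmetric : forall t f g, 0 <= t ->
    f \in Lfun mu 2%:E -> g \in Lfun mu 2%:E ->
    \int[mu]_x (f x * P t g x) = \int[mu]_x (P t f x * g x) ;
  semigroup0 : forall f, f \in Lfun mu 2%:E ->
    {ae mu, forall x, P 0 f x = f x} ;
  semigroupD : forall s t f, 0 <= s -> 0 <= t -> f \in Lfun mu 2%:E ->
    {ae mu, forall x, P (s + t) f x = P s (P t f) x} ;
  semigroup_continuous : forall f, f \in Lfun mu 2%:E ->
    (fun t => L2norm (P t f \- f)) @ 0^'+ --> (0 : R) }.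

Definition is_generator (f g : T -> R) : Prop :=
  [/\ f \in Lfun mu 2%:E, g \in Lfun mu 2%:E &
    (fun t => L2norm (fun x => t^-1 * (P t f x - f x) - g x)) @ 0^'+
      --> (0 : R)].

Definition gen_dom : set (T -> R) := [set f | exists g, is_generator f g].

(* A representative of the L2-derivative at 0+ of t |-> P t f; it is unique
   up to mu-a.e. equality when f is in the domain. *)
Definition gen (f : T -> R) : T -> R := xget (cst 0) (is_generator f).

Definition carre_du_champ (f : T -> R) (x : T) : R :=
  gen (f \* f) x - 2 * (f x * gen f x).

Definition dirichlet (f g : T -> R) : R :=
  - 2 * \int[mu]_x (f x * gen g x).

Record core_algebra (D : set (T -> R)) : Prop := CoreAlgebra {
  core_dom : D `<=` gen_dom ;
  core_bounded : forall f, D f -> exists M : R, forall x, `|f x| <= M ;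
  core_linear : forall a f g, D f -> D g -> D (fun x => a * f x + g x) ;
  core_mul : forall f g, D f -> D g -> D (f \* g) ;
  core_dense : forall f e, gen_dom f -> 0 < e ->
    exists g, [/\ D g, L2norm (f \- g) < e & L2norm (gen f \- gen g) < e] }.

(* With [dirichlet f f = - 2 \int f L f], the carre du champ above is
   L(f^2) - 2 f L f (that is |nabla f|^2 for L = Delta/2 - nabla V . nabla),
   whence the factor 1/2 in the second order chain rule. *)
Definition diffusion (D : set (T -> R)) : Prop :=
  forall (f : T -> R) (Phi : R -> R), D f -> smooth_on setT Phi ->
    gen_dom (Phi \o f) /\
    {ae mu, forall x, gen (Phi \o f) x =
      (Phi^`()%classic) (f x) * gen f x + 2^-1 * ((Phi^`(2)%classic) (f x) * carre_du_champ f x)}.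

Definition orlicz_opnorm (tau : R -> R) (t : R) : \bar R :=
  ereal_sup [set gauge tau (P t f) | f in
    [set f : T -> R | f \in Lfun mu 2%:E /\ L2norm f <= 1]].

Definition orlicz_hyperbounded (tau : R -> R) (t : R) : Prop :=
  (forall f, f \in Lfun mu 2%:E -> Lorlicz tau (P t f)) /\
  (orlicz_opnorm tau t < +oo)%E.

Definition orlicz_hypercontractive (tau : R -> R) (t : R) : Prop :=
  forall f, f \in Lfun mu 2%:E ->
    Lorlicz tau (P t f) /\ (gauge tau (P t f) <= (L2norm f)%:E)%E.

Definition orlicz_entropy (taus : R -> R) (f : T -> R) : \bar R :=
  let n := L2norm f in
  (\int[mu]_x (extend0 (fun y => y ^+ 2 *
     ln (inv_nneg taus (taus 1 * (y / n) ^+ 2) / `|y / n|)) (f x))%:E)%E.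

End orlicz_semigroup.

(* Main.v *)
Require Import Defs.
From HB Require Import structures.
From mathcomp Require Import all_boot all_order all_algebra.
From mathcomp Require Import all_classical all_reals all_analysis.
From mathcomp Require Import measurable_realfun ring lra.
Import Order.TTheory GRing.Theory Num.Theory.
Import numFieldNormedType.Exports.
Local Open Scope classical_set_scope.
Local Open Scope ring_scope.

(** The inequality is the derivative at 0 of an interpolation inequality
    between [f] and the function dual to it in the Orlicz sense.

    Put [n = L2norm f], let [G >= 0] solve [taus G = taus 1 * (f / n) ^ 2], so
    that [taus G] has integral [taus 1], and let [r = n G / |f|]; the
    Orlicz entropy of [f] is the integral of [f^2 ln r].  The curve
    [u s = |f| r^s] joins [|f|] to [n G].  Young's inequality
    [x y <= tau x + taus y] and the normalization [tau 1 + taus 1 = 1] give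
    [<h, G> <= gauge h] ([inner_le_gauge]), so the Orlicz bound on [P t0] yields
    [<P t0 |f|, u 1> <= C n^2].  The claim is then that
    [<u s, P (2 s t0) (u s)> <= C^(2 s) n^2], a Stein interpolation, which for
    [s = 2^-(k+1)] follows by bisection from positivity alone.  A symmetric
    positive operator [Q] satisfies [<h, Q h> <= <f, Q g>] whenever
    [h^2 = f g] and all are nonnegative ([semigroup_geometric_mean]): were [Q]
    given by a kernel, this would be the arithmetic-geometric inequality
    [2 h(x) h(y) <= f(x) g(y) + g(x) f(y)].  Since [u (s / 2)] is the geometric
    mean of [|f|] and [u s], this bounds [<u (s/2), P (s t0) (u (s/2))>] by
    [<|f|, P (s t0) (u s)>], hence by [n] times the square root of
    [<u s, P (2 s t0) (u s)>], and each bisection halves the exponent of [C].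

    Next, replace [u s] by its signed version [v s = f r^s], which only lowers
    the left-hand side, and write [v s = f + s w].  As [P t] is
    positive semidefinite, [<v, P t v>] lies above its tangent at [f], so
    [<f, P t f> + 2 s <w, P t f> <= C^(2 s) n^2] with [t = 2 s t0].  From
    [1 + x <= e^x] follows [w f >= f^2 ln r], whatever [s] is, so that [<w, f>]
    is at least the entropy.  Since [f] is bounded, so is [w], uniformly in [s];
    hence [P t f] may be replaced by [f] in [<w, P t f>] up to an error that
    vanishes with [t].  Subtracting [n^2], dividing by [2 s] and letting [s] go
    to 0 gives [Ent f + t0 <f, L f> <= n^2 ln C]
    ([orlicz_entropy_le_generator]), which is the theorem.

    The integrand [f^2 ln r] tends to 0 where [f] does, because convexity of
    [taus] forces [(f / n)^2 <= G <= 1] as soon as [|f| <= n]; its continuous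
    extension at the zeros of [f] is therefore 0. *)

(** * The Hilbert space structure of square integrable functions *)

Section square_integrable.
Context {d : measure_display} {T : measurableType d} {R : realType}.
Variable mu : probability T R.
Implicit Types f g h : T -> R.

Local Notation L2 := (Lfun mu 2%:E).

Definition L2inner f g : R := \int[mu]_x (f x * g x).

Local Notation inner := L2inner.

Lemma L2_measurable f : f \in L2 -> measurable_fun setT f.
Proof. by rewrite inE => /andP[/[!inE]]. Qed.

Lemma L2_cst (c : R) : (fun=> c) \in L2.
Proof. exact: Lfun_cst. Qed.

Lemma L2_lin (a : R) f g : f \in L2 -> g \in L2 ->
  (fun x => a * f x + g x) \in L2.
Proof.
have p1 : (1 <= 2%:E :> \bar R)%E by rewrite lee_fin ler1n.
by move=> fL gL; have [_] := @Lfun_submod_closed _ T R mu _ p1; apply.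
Qed.

Lemma L2_scale (a : R) f : f \in L2 -> (fun x => a * f x) \in L2.
Proof.
move=> fL; have := L2_lin a _ _ fL (L2_cst 0).
by under eq_fun do rewrite addr0.
Qed.

Lemma L2_sub f g : f \in L2 -> g \in L2 -> (fun x => f x - g x) \in L2.
Proof.
move=> fL gL; have := L2_lin (-1) _ _ gL fL.
by under eq_fun do rewrite mulN1r addrC.
Qed.

Lemma L2_dominated f g : measurable_fun setT f -> g \in L2 ->
  (forall x, `|f x| <= `|g x|) -> f \in L2.
Proof.
move=> mf gL fg; rewrite inE; apply/andP; split; rewrite inE//=.
move: (gL); rewrite inE => /andP[/[!inE]/= mg]; apply: le_lt_trans.
rewrite unlock /= gt0_ler_poweR ?invr_ge0//.
- by rewrite in_itv/= leey andbT; rewrite integral_ge0.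
- by rewrite in_itv/= leey andbT; rewrite integral_ge0.
apply: ge0_le_integral => //.
- apply/measurable_EFinP/(@measurableT_comp _ _ _ _ _ _ (fun x : R => x `^ 2)%R) => //.
  exact: measurableT_comp.
- apply/measurable_EFinP/(@measurableT_comp _ _ _ _ _ _ (fun x : R => x `^ 2)%R) => //.
  exact: measurableT_comp.
- by move=> x _; rewrite lee_fin ge0_ler_powR ?nnegrE.
Qed.

Lemma L2_bounded f (M : R) : measurable_fun setT f ->
  (forall x, `|f x| <= M) -> f \in L2.
Proof.
move=> mf fM; apply: (L2_dominated f _ mf (L2_cst M)) => x.
by rewrite (le_trans (fM x))// ler_norm.
Qed.

Lemma L2_abs f : f \in L2 -> (fun x => `|f x|) \in L2.
Proof.
move=> fL; apply: (L2_dominated _ _ _ fL).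
  by apply: measurableT_comp => //; exact: L2_measurable.
by move=> x; rewrite normr_id.
Qed.

Lemma integrable_mul f g : f \in L2 -> g \in L2 ->
  mu.-integrable setT (EFin \o (fun x => f x * g x)).
Proof. by move=> fL gL; apply/Lfun1_integrable/Lfun2_mul_Lfun1. Qed.

Lemma innerC f g : inner f g = inner g f.
Proof. by rewrite /L2inner; under eq_Rintegral do rewrite mulrC. Qed.

Lemma inner_linr f (a : R) g h : f \in L2 -> g \in L2 -> h \in L2 ->
  inner f (fun x => a * g x + h x) = a * inner f g + inner f h.
Proof.
move=> fL gL hL; rewrite /L2inner -RintegralZl//; last exact: integrable_mul.
rewrite -RintegralD//; last 2 first.
- have := integrable_mul f (fun x => a * g x) fL (L2_scale a _ gL).
  by under [EFin \o _]eq_fun do rewrite /= mulrCA.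
- exact: integrable_mul.
by under eq_Rintegral do rewrite mulrDr mulrCA.
Qed.

Lemma inner_scaler f (a : R) g : f \in L2 -> g \in L2 ->
  inner f (fun x => a * g x) = a * inner f g.
Proof.
move=> fL gL; rewrite /L2inner -RintegralZl//; last exact: integrable_mul.
by under eq_Rintegral do rewrite mulrCA.
Qed.

Lemma inner_subr f g h : f \in L2 -> g \in L2 -> h \in L2 ->
  inner f (fun x => g x - h x) = inner f g - inner f h.
Proof.
move=> fL gL hL; have := inner_linr f (-1) h g fL hL gL.
under [fun x => _ + _]eq_fun do rewrite mulN1r addrC.
by move=> ->; rewrite mulN1r addrC.
Qed.

Lemma inner_subl f g h : f \in L2 -> g \in L2 -> h \in L2 ->
  inner (fun x => g x - h x) f = inner g f - inner h f.
Proof. by move=> *; rewrite innerC inner_subr// !(innerC f). Qed.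

Lemma le_Rintegral_ae f g : mu.-integrable setT (EFin \o f) ->
  mu.-integrable setT (EFin \o g) -> {ae mu, forall x, f x <= g x} ->
  \int[mu]_x f x <= \int[mu]_x g x.
Proof.
move=> fi gi le; rewrite -subr_ge0 -RintegralB//; pose F x := g x - f x.
have iF : mu.-integrable setT (EFin \o F) by exact: (integrableB _ gi fi).
have mF : measurable_fun setT (EFin \o F) by case/integrableP : iF.
rewrite /Rintegral (_ : \int[mu]_x (F x)%:E = \int[mu]_x (`|F x|)%:E)%E.
  by rewrite fine_ge0// integral_ge0.
apply: ae_eq_integral => //.
- by apply/measurable_EFinP; apply: measurableT_comp => //; apply/measurable_EFinP.
- by apply: filterS le => x + _; rewrite -subr_ge0 -/(F x) => /ger0_norm ->.
Qed.

Lemma le_inner f g h k : f \in L2 -> g \in L2 -> h \in L2 -> k \in L2 ->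
  {ae mu, forall x, f x * g x <= h x * k x} -> inner f g <= inner h k.
Proof. by move=> *; apply: le_Rintegral_ae => //; exact: integrable_mul. Qed.

Lemma inner_ae_eqr f g h : f \in L2 -> g \in L2 -> h \in L2 ->
  {ae mu, forall x, g x = h x} -> inner f g = inner f h.
Proof.
move=> fL gL hL gh; apply/eqP; rewrite eq_le !le_inner//.
  by apply: filterS gh => x ->.
by apply: filterS gh => x ->.
Qed.

Lemma Lnorm2_fin f : f \in L2 -> ('N[mu]_2%:E[EFin \o f])%E = (L2norm mu f)%:E.
Proof.
move=> /sub_Lfun_finLfun; rewrite inE/= => fi.
by rewrite /L2norm fineK// ge0_fin_numE ?Lnorm_ge0.
Qed.

Lemma L2norm_ge0 f : 0 <= L2norm mu f.
Proof. exact/fine_ge0/Lnorm_ge0. Qed.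

Lemma inner_diag f : f \in L2 -> inner f f = L2norm mu f ^+ 2.
Proof.
move=> fL; have h : (2:R) != 0 by [].
have := powR_Lnorm mu (EFin \o f) h; rewrite (Lnorm2_fin f fL).
rewrite poweR_EFin powR_mulrn ?L2norm_ge0// => nE.
rewrite /L2inner /Rintegral -[RHS]/(fine (L2norm mu f ^+ 2)%:E) nE.
congr fine; apply: eq_integral => x _ /=.
by rewrite powR_mulrn// real_normK ?num_real.
Qed.

Lemma inner_Cauchy_Schwarz f g : f \in L2 -> g \in L2 ->
  `|inner f g| <= L2norm mu f * L2norm mu g.
Proof.
move=> fL gL; rewrite -lee_fin EFinM -!Lnorm2_fin//.
rewrite EFin_normr_Rintegral//; last exact: integrable_mul.
have ifg := integrable_mul f g fL gL.
apply: le_trans.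
  apply: le_abse_integral => //; by case/integrableP : ifg.
rewrite -(Lnorm1 mu (EFin \o (f \* g)%R)).
apply: hoelder => //; try exact: L2_measurable.
by rewrite [RHS]splitr !div1r.
Qed.

Lemma L2norm_cst1 : L2norm mu (fun=> 1) = 1.
Proof.
have := inner_diag _ (L2_cst 1).
rewrite /L2inner Rintegral_cst// [X in fine X](@probability_setT _ _ _ mu) /= !mulr1 => /esym/eqP.
rewrite sqrp_eq1 ?L2norm_ge0// => /eqP //.
Qed.

Lemma L2norm_le_bound f (M : R) : f \in L2 -> 0 <= M ->
  (forall x, `|f x| <= M) -> L2norm mu f <= M.
Proof.
move=> fL M0 fM; rewrite -(@ler_pXn2r _ 2) ?nnegrE ?L2norm_ge0// -inner_diag//.
have -> : M ^+ 2 = inner (fun=> M) (fun=> M).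
  rewrite /L2inner Rintegral_cst// [X in fine X](@probability_setT _ _ _ mu) /=.
  by rewrite mulr1.
apply: le_inner; rewrite ?L2_cst//; apply: aeW => x.
by rewrite -!expr2 -real_normK ?num_real// lerXn2r ?nnegrE.
Qed.

Lemma L2norm_scale (a : R) f : f \in L2 ->
  L2norm mu (fun x => a * f x) = `|a| * L2norm mu f.
Proof.
move=> fL; apply/eqP; rewrite -(@eqrXn2 _ 2)//; last 2 first.
- exact: L2norm_ge0.
- by rewrite mulr_ge0// L2norm_ge0.
rewrite exprMn -!inner_diag ?L2_scale// inner_scaler ?L2_scale// innerC.
by rewrite inner_scaler// mulrA -expr2 real_normK ?num_real.
Qed.

Lemma L2norm_abs f : f \in L2 -> L2norm mu (fun x => `|f x|) = L2norm mu f.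
Proof.
move=> fL; apply/eqP; rewrite -(@eqrXn2 _ 2)// ?L2norm_ge0//.
rewrite -!inner_diag ?L2_abs// /L2inner.
by under eq_Rintegral do rewrite -expr2 real_normK ?num_real// expr2.
Qed.

End square_integrable.

(** * Symmetric Markov semigroups as positive operators *)

(** Positivity of a Markov operator gives only countably many almost sure
    inequalities at once; this passes from rational to real parameters. *)
Lemma quadratic_ge0_rat (R : realType) (a b c : R) :
  (forall q : rat, 0 <= a * ratr q ^+ 2 - 2 * b * ratr q + c) ->
  forall x : R, 0 <= a * x ^+ 2 - 2 * b * x + c.
Proof.
move=> rat_ge0 x; rewrite leNgt; apply/negP => px.
pose p (y : R) := a * y ^+ 2 - 2 * b * y + c.
have cp : continuous p.
  move=> y; apply: cvgD; last exact: cvg_cst.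
  apply: cvgB; first by apply: cvgM; [exact: cvg_cst|exact: exprn_continuous].
  by apply: cvgM; [exact: cvg_cst|exact: cvg_id].
have op : open (p @^-1` [set y | y < 0]).
  by apply: open_comp => [y _|]; [exact: cp|exact: open_lt].
have p0 : (p @^-1` [set y | y < 0]) !=set0 by exists x.
have [y [/= py [q _ qy]]] := @dense_rat R _ p0 op.
by have := rat_ge0 q; rewrite qy leNgt py.
Qed.

Lemma ae_forall_rat {d} {T : measurableType d} {R : realType}
    (mu : {measure set T -> \bar R}) (Q : rat -> T -> Prop) :
  (forall q, {ae mu, forall x, Q q x}) -> {ae mu, forall x, forall q, Q q x}.
Proof.
move=> Qae.
have /ae_foralln : forall n, \forall x \ae mu,
    if unpickle n is Some q then Q q x else True.
  by move=> n; case: (unpickle n) => [q|]; [exact: Qae|exact: nearW].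
by apply: filterS => x Qx q; have := Qx (pickle q); rewrite pickleK.
Qed.

Section semigroup.
Context {d : measure_display} {T : measurableType d} {R : realType}.
Variable mu : probability T R.
Variable P : R -> (T -> R) -> T -> R.
Hypothesis hP : symmetric_markov_semigroup mu P.
Implicit Types (t : R) (f g h u v : T -> R).

Local Notation L2 := (Lfun mu 2%:E).
Local Notation inner := (L2inner mu).

Let PL2 t f : 0 <= t -> f \in L2 -> P t f \in L2.
Proof. exact: semigroup_Lfun hP _ _. Qed.

Lemma semigroup_scale t (a : R) f : 0 <= t -> f \in L2 ->
  {ae mu, forall x, P t (fun y => a * f y) x = a * P t f x}.
Proof.
move=> t0 fL; have c0 := L2_cst mu 0.
have := semigroup_linear hP 1 t0 c0 c0; have := semigroup_linear hP a t0 fL c0.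
rewrite [X in P t X](_ : _ = fun y => a * f y); last first.
  by apply/funext => y; rewrite addr0.
rewrite [X in _ -> {ae mu, forall x, P t X x = _} -> _](_ : _ = fun=> 0); last first.
  by apply/funext => y; rewrite addr0 mulr0.
apply: filterS2 => x -> e0; suff -> : P t (fun=> 0) x = 0 by rewrite addr0.
by move: e0; rewrite mul1r; lra.
Qed.

Lemma semigroup_sub t f g : 0 <= t -> f \in L2 -> g \in L2 ->
  {ae mu, forall x, P t (fun y => f y - g y) x = P t f x - P t g x}.
Proof.
move=> t0 fL gL; have := semigroup_linear hP (-1) t0 gL fL.
rewrite [X in P t X](_ : _ = fun y => f y - g y); last first.
  by apply/funext => y; rewrite mulN1r addrC.
by apply: filterS => x ->; rewrite mulN1r addrC.
Qed.

Lemma semigroup_le t f g : 0 <= t -> f \in L2 -> g \in L2 ->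
  (forall x, f x <= g x) -> {ae mu, forall x, P t f x <= P t g x}.
Proof.
move=> t0 fL gL fg; have := semigroup_sub _ _ _ t0 gL fL.
have : {ae mu, forall x, 0 <= P t (fun y => g y - f y) x}.
  apply: (semigroup_positive hP t0); first exact: L2_sub.
  by apply: aeW => x; rewrite subr_ge0.
by apply: filterS2 => x + e; rewrite e subr_ge0.
Qed.

Lemma semigroup_inner_subr t f g h : 0 <= t -> f \in L2 -> g \in L2 -> h \in L2 ->
  inner f (P t (fun x => g x - h x)) = inner f (P t g) - inner f (P t h).
Proof.
move=> t0 fL gL hL; rewrite -inner_subr ?PL2//.
apply: inner_ae_eqr => //; rewrite ?PL2 ?L2_sub ?PL2//.
exact: semigroup_sub.
Qed.

(** Symmetry and [P t = P (t / 2) P (t / 2)]: this makes [P t] positive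
    semidefinite, and turns a norm into a quadratic form at twice the time. *)
Lemma semigroup_inner_square t f : 0 <= t -> f \in L2 ->
  inner f (P t f) = L2norm mu (P (t / 2) f) ^+ 2.
Proof.
move=> t0 fL; have h0 : 0 <= t / 2 by rewrite divr_ge0.
rewrite -inner_diag ?PL2// /L2inner -(semigroup_symmetric hP)// ?PL2//.
apply: (inner_ae_eqr mu) => //; rewrite ?PL2//.
by have := semigroupD hP h0 h0 fL; rewrite -splitr.
Qed.

(** The quadratic form of [P t] is convex, hence above its tangent at [f]. *)
Lemma semigroup_inner_tangent t u f : 0 <= t -> u \in L2 -> f \in L2 ->
  2 * inner u (P t f) - inner f (P t f) <= inner u (P t u).
Proof.
move=> t0 uL fL; have uf := L2_sub mu u f uL fL.
have : 0 <= inner (fun x => u x - f x) (P t (fun x => u x - f x)).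
  by rewrite semigroup_inner_square// sqr_ge0.
rewrite semigroup_inner_subr// !inner_subl ?PL2//.
have -> : inner f (P t u) = inner u (P t f).
  by rewrite /L2inner (semigroup_symmetric hP)// -/(L2inner mu _ _) innerC.
by lra.
Qed.

Lemma semigroup_inner_abs t v : 0 <= t -> v \in L2 ->
  inner v (P t v) <= inner (fun x => `|v x|) (P t (fun x => `|v x|)).
Proof.
move=> t0 vL; have aL := L2_abs mu v vL.
apply: le_inner; rewrite ?PL2//.
have Nle : {ae mu, forall x, P t (fun y => -1 * v y) x <= P t (fun x => `|v x|) x}.
  apply: semigroup_le => // [|x]; first exact: L2_scale.
  by rewrite mulN1r -normrN ler_norm.
have Ple : {ae mu, forall x, P t v x <= P t (fun x => `|v x|) x}.
  by apply: semigroup_le => // x; exact: ler_norm.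
have := semigroup_scale _ (-1) _ t0 vL; move: Nle Ple.
apply: filterS3 => x + + e; rewrite e mulN1r => Nle Ple.
rewrite (le_trans (ler_norm _))// normrM ler_wpM2l//.
by rewrite ler_norml -lerNl Nle.
Qed.

(** The arithmetic-geometric inequality
    [2 h(x) h(y) <= f(x) g(y) + g(x) f(y)] integrated against the kernel of
    [P t], proved without a kernel: since [h^2 = f g], the function
    [a^2 f - 2 a h + g] is nonnegative for each constant [a], hence so is its
    image; then choose [a = h(x) / f(x)] at the point [x]. *)
Lemma semigroup_geometric_mean t f g h : 0 <= t ->
  f \in L2 -> g \in L2 -> h \in L2 ->
  (forall x, 0 <= f x) -> (forall x, 0 <= g x) -> (forall x, 0 <= h x) ->
  (forall x, h x ^+ 2 = f x * g x) ->
  inner h (P t h) <= inner f (P t g).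
Proof.
move=> t0 fL gL hL f0 g0 h0 hfg.
have Pquad : {ae mu, forall x, forall q : rat,
    0 <= P t f x * ratr q ^+ 2 - 2 * P t h x * ratr q + P t g x}.
  apply: ae_forall_rat => q; set a : R := ratr q.
  have kL := L2_lin mu (- (2 * a)) h g hL gL.
  have pos : {ae mu, forall x,
      0 <= P t (fun y => a ^+ 2 * f y + (- (2 * a) * h y + g y)) x}.
    apply: (semigroup_positive hP t0); first exact: L2_lin.
    apply: aeW => x.
    have [fx0|fx0] := eqVneq (f x) 0.
      have /eqP := hfg x; rewrite fx0 mul0r sqrf_eq0 => /eqP ->.
      by rewrite !mulr0 !add0r.
    have fx : 0 < f x by rewrite lt_neqAle eq_sym fx0 f0.
    rewrite -(pmulr_rge0 _ fx).
    have -> : f x * (a ^+ 2 * f x + (- (2 * a) * h x + g x)) =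
      (a * f x - h x) ^+ 2 + (f x * g x - h x ^+ 2) by ring.
    by rewrite -hfg subrr addr0 sqr_ge0.
  have := semigroup_linear hP (a ^+ 2) t0 fL kL.
  have := semigroup_linear hP (- (2 * a)) t0 hL gL.
  move: pos; apply: filterS3 => x + e1 e2; rewrite e2 e1.
  suff -> : a ^+ 2 * P t f x + (- (2 * a) * P t h x + P t g x) =
    P t f x * a ^+ 2 - 2 * P t h x * a + P t g x by [].
  by ring.
have le2 : {ae mu, forall x, 2 * (h x * P t h x) <= f x * P t g x + g x * P t f x}.
  have : {ae mu, forall x, 0 <= P t f x}.
    by apply: (semigroup_positive hP t0) => //; exact: aeW.
  apply: filterS2 Pquad => x /quadratic_ge0_rat quad Pf0.
  have [fx0|fx0] := eqVneq (f x) 0.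
    have /eqP := hfg x; rewrite fx0 mul0r sqrf_eq0 => /eqP ->.
    by rewrite !mul0r mulr0 add0r mulr_ge0.
  have fx : 0 < f x by rewrite lt_neqAle eq_sym fx0 f0.
  have gE : g x = h x ^+ 2 / f x by rewrite hfg mulrAC divff ?mul1r.
  rewrite -subr_ge0 gE.
  suff -> : f x * P t g x + h x ^+ 2 / f x * P t f x - 2 * (h x * P t h x) =
    f x * (P t f x * (h x / f x) ^+ 2 - 2 * P t h x * (h x / f x) + P t g x).
    by rewrite mulr_ge0.
  by field.
have PLf := PL2 t f t0 fL; have PLg := PL2 t g t0 gL; have PLh := PL2 t h t0 hL.
have sym : inner g (P t f) = inner f (P t g).
  by rewrite innerC /L2inner (semigroup_symmetric hP).
rewrite -(ler_pM2l (ltr0n _ 2)) [leRHS]mulr_natl mulr2n -[X in _ <= _ + X]sym.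
have ihh := integrable_mul mu h (P t h) hL PLh.
have ifg := integrable_mul mu f (P t g) fL PLg.
have igf := integrable_mul mu g (P t f) gL PLf.
rewrite /L2inner -RintegralD// -RintegralZl//; apply: le_Rintegral_ae => //.
- exact: (integrableZl _ _ ihh).
- exact: (integrableD _ ifg igf).
Qed.

End semigroup.

(** * Young functions and the dual profile of the entropy *)

Lemma expR_chord (R : realType) (s x : R) : 0 <= s <= 1 ->
  expR (s * x) <= 1 - s + s * expR x.
Proof.
move=> s01; have hs : Itv.spec (@Itv.num_sem R) (Itv.Real `[0%Z, 1%Z]) s.
  by rewrite /= /Itv.num_sem/= num_real/= in_itv/=.
have := convex_expR (Itv.mk hs) x 0; rewrite !convRE /= expR0.
by rewrite mulr0 mulr1 addr0 addrC.
Qed.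

Lemma le_expR_quotient (R : realType) (s x : R) : 0 < s ->
  x <= (expR (s * x) - 1) / s.
Proof. by move=> s0; rewrite ler_pdivlMr// mulrC lerBrDl expR_ge1Dx. Qed.

Section young.
Context {R : realType} {phi : R -> R}.
Hypothesis hphi : young_function phi.
Local Notation inv := (inv_nneg phi).

Lemma young_lt x y : 0 <= x -> x < y -> phi x < phi y.
Proof.
move=> x0 xy; apply: (young_increasing hphi) => //; rewrite in_itv/= andbT//.
by rewrite (le_trans x0 (ltW xy)).
Qed.

Lemma young_le x y : 0 <= x -> x <= y -> phi x <= phi y.
Proof.
by move=> x0; rewrite le_eqVlt => /predU1P[->//|/(young_lt _ _ x0)/ltW].
Qed.

Lemma young_gt0 x : 0 < x -> 0 < phi x.
Proof. by move=> x0; rewrite -(young0 hphi) young_lt. Qed.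

Lemma young_ge0 x : 0 <= phi x.
Proof.
wlog x0 : x / 0 <= x => [H|].
  have [/H//|/ltW x0] := leP 0 x.
  by rewrite -(young_even hphi) H// oppr_ge0.
by rewrite -(young0 hphi) young_le.
Qed.

Lemma young_le_scale (t x : R) : 0 <= t <= 1 -> phi (t * x) <= t * phi x.
Proof.
move=> t01; have ht : Itv.spec (@Itv.num_sem R) (Itv.Real `[0%Z, 1%Z]) t.
  by rewrite /= /Itv.num_sem/= num_real/= in_itv/=.
have : phi (t * x + (1 - t) * 0) <= t * phi x + (1 - t) * phi 0.
  exact: (young_convex hphi (Itv.mk ht) (mem_set (I : setT x)) (mem_set (I : setT (0:R)))).
by rewrite (young0 hphi) !mulr0 !addr0.
Qed.

Lemma young_surj y : 0 <= y -> exists2 x, 0 <= x & phi x = y.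
Proof.
move=> y0; have p1 := young_gt0 1 ltr01; pose b := 1 + y / phi 1.
have b1 : 1 <= b by rewrite lerDl divr_ge0// ltW.
have b0 : 0 < b by rewrite (lt_le_trans ltr01).
have yb : y <= phi b.
  have h := young_le_scale b^-1 b; rewrite mulVf ?gt_eqF// in h.
  have {h} : phi 1 <= b^-1 * phi b.
    by apply: h; rewrite invr_ge0 (ltW b0) invf_le1.
  rewrite ler_pdivlMl// => /(le_trans _); apply.
  by rewrite mulrDl mul1r -mulrA mulVf ?gt_eqF// mulr1 lerDr ltW.
have [||x] := @IVT R phi 0 b y (ltW b0).
- by apply: continuous_subspaceT; exact: young_continuous hphi.
- rewrite (young0 hphi); have pb := young_ge0 b.
  by rewrite min_l// max_r// y0 yb.
by rewrite in_itv/= => /andP[x0 _] <-; exists x.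
Qed.

Lemma inv_nneg_spec y : 0 <= y -> 0 <= inv y /\ phi (inv y) = y.
Proof.
move=> y0; have [x x0 xy] := young_surj y y0.
have yimg : y \in phi @` `[0, +oo[%classic.
  by rewrite inE; exists x => //=; rewrite in_itv/= x0.
have phiK : phi (inv y) = y by rewrite /inv_nneg pinvK.
split=> //.
have inj : {in `[0, +oo[%classic &, injective phi}.
  move=> a b; rewrite !inE/= !in_itv/= !andbT => a0 b0 ab.
  apply/eqP; rewrite eq_le !leNgt; apply/andP; split; apply/negP.
    by move=> /(young_lt _ _ b0); rewrite ab ltxx.
  by move=> /(young_lt _ _ a0); rewrite ab ltxx.
rewrite -xy /inv_nneg pinvKV// inE/= in_itv/= x0//.
Qed.

Lemma inv_nneg_ge0 y : 0 <= y -> 0 <= inv y.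
Proof. by move=> /inv_nneg_spec[]. Qed.

Lemma inv_nnegK y : 0 <= y -> phi (inv y) = y.
Proof. by move=> /inv_nneg_spec[]. Qed.

Lemma le_inv_nneg x y : 0 <= y -> phi x <= y -> x <= inv y.
Proof.
move=> y0 xy; rewrite leNgt; apply/negP => /(young_lt _ _ (inv_nneg_ge0 y y0)).
by rewrite inv_nnegK// ltNge xy.
Qed.

Lemma inv_nneg_le x y : 0 <= x -> 0 <= y -> y <= phi x -> inv y <= x.
Proof.
by move=> x0 y0 yx; rewrite leNgt; apply/negP => /(young_lt _ _ x0);
  rewrite inv_nnegK// ltNge yx.
Qed.

(** Composed with a function [f] of norm 1, this gives the function [G] such
    that [phi \o G = phi 1 * f^2]: it lies on the sphere of the
    Orlicz space of [phi], as [f] lies on that of [L2]. *)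
Definition companion (y : R) := inv (phi 1 * y ^+ 2).

Let arg_ge0 y : 0 <= phi 1 * y ^+ 2.
Proof. by rewrite mulr_ge0 ?young_ge0 ?sqr_ge0. Qed.

Lemma companion_ge0 y : 0 <= companion y.
Proof. exact: inv_nneg_ge0. Qed.

Lemma young_companion y : phi (companion y) = phi 1 * y ^+ 2.
Proof. exact: inv_nnegK. Qed.

Lemma companion_le y z : `|y| <= `|z| -> companion y <= companion z.
Proof.
move=> yz; apply: le_inv_nneg => //; rewrite young_companion.
by rewrite ler_wpM2l ?young_ge0// -[leLHS]real_normK ?num_real//
  -[leRHS]real_normK ?num_real// lerXn2r.
Qed.

Lemma companion1 : companion 1 = 1.
Proof.
apply/eqP; rewrite eq_le /companion expr1n mulr1.
by rewrite inv_nneg_le ?young_ge0// le_inv_nneg ?young_ge0.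
Qed.

(** By convexity [phi (y^2) <= y^2 * phi 1] when [y^2 <= 1].  This keeps the
    companion away from 0 quantitatively, so that [y^2 * log_ratio y] vanishes
    at the origin. *)
Lemma companion_ge_sqr y : `|y| <= 1 -> y ^+ 2 <= companion y.
Proof.
move=> y1; apply: le_inv_nneg => //; rewrite -[X in phi X]mulr1 mulrC.
rewrite [leRHS]mulrC [X in phi X]mulrC young_le_scale// sqr_ge0/=.
by rewrite -real_normK ?num_real// exprn_ile1.
Qed.

Lemma companion_gt0 y : y != 0 -> 0 < companion y.
Proof.
move=> y0; rewrite lt_neqAle companion_ge0 andbT; apply/eqP => c0.
have := young_companion y; rewrite -c0 (young0 hphi) => /esym/eqP.
by rewrite mulf_eq0 gt_eqF ?young_gt0//= sqrf_eq0 (negbTE y0).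
Qed.

Lemma measurable_companion : measurable_fun setT companion.
Proof.
(* A nondecreasing function on the whole line is needed, hence the maximum. *)
have -> : companion = (fun z : R => inv (Num.max z 0)) \o (fun y => phi 1 * y ^+ 2).
  by apply/funext => y /=; rewrite max_l.
apply: measurableT_comp.
  apply: nondecreasing_measurable => // y z yz.
  have [y0 z0] : 0 <= Num.max y 0 /\ 0 <= Num.max z 0 by rewrite !le_max !lexx !orbT.
  apply: le_inv_nneg => //; rewrite inv_nnegK//.
  by rewrite ge_max !le_max yz lexx !orbT.
by apply: measurable_funM => //; exact: measurable_funX.
Qed.

Definition log_ratio (y : R) := ln (companion y / `|y|).

Lemma measurable_log_ratio : measurable_fun setT log_ratio.
Proof.
have -> : log_ratio = fun y => ln (companion y) - ln `|y|.
  apply/funext => y; have [->|y0] := eqVneq y 0.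
    rewrite /log_ratio normr0 invr0 mulr0 ln0// subr0 ln0//.
    by rewrite inv_nneg_le// expr0n/= mulr0 ?(young0 hphi).
  by rewrite /log_ratio ln_div// posrE ?companion_gt0 ?normr_gt0.
apply: measurable_funB; apply: measurableT_comp => //.
exact: measurable_companion.
Qed.

Lemma expR_log_ratio y : y != 0 -> `|y| * expR (log_ratio y) = companion y.
Proof.
move=> y0; have ny : 0 < `|y| by rewrite normr_gt0.
rewrite lnK ?posrE ?divr_gt0 ?companion_gt0//.
by rewrite mulrCA divff ?mulr1// gt_eqF.
Qed.

Let ln_ge (x : R) : 0 < x -> 1 - x^-1 <= ln x.
Proof.
move=> x0; have xi : 0 < x^-1 by rewrite invr_gt0.
have := @le_ln1Dx R (x^-1 - 1); rewrite ltrBrDl subrr xi => /(_ isT).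
by rewrite addrC subrK lnV ?posrE//; lra.
Qed.

(** The companion is at least [y^2] when [|y| <= 1] and at least 1 otherwise, so
    [log_ratio y >= - |ln |y||]; the factor [|y|] absorbs that logarithm. *)
Lemma log_ratio_ge y : y != 0 -> - (1 + y ^+ 2) <= `|y| * log_ratio y.
Proof.
move=> y0; have ny : 0 < `|y| by rewrite normr_gt0.
have n2 : y ^+ 2 = `|y| ^+ 2 by rewrite real_normK ?num_real.
have c0 := companion_gt0 y y0.
have [y1|/ltW y1] := leP `|y| 1.
  have lbd : `|y| <= companion y / `|y|.
    by rewrite ler_pdivlMr// -expr2 -n2 companion_ge_sqr.
  have h : 1 - `|y|^-1 <= log_ratio y.
    by rewrite (le_trans (ln_ge _ ny))// ler_ln ?posrE ?divr_gt0.
  have := ler_wpM2l (ltW ny) h; rewrite mulrBr mulr1 divff ?gt_eqF//.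
  by apply: le_trans; rewrite n2; nra.
have cge : 1 <= companion y by rewrite -companion1 companion_le// normr1.
have lbd : `|y|^-1 <= companion y / `|y|.
  by rewrite -[leLHS]mul1r ler_wpM2r// invr_ge0.
have h : - `|y| <= log_ratio y.
  rewrite (@le_trans _ _ (ln `|y|^-1))//.
    by rewrite lnV ?posrE// lerN2 ltW// ln_sublinear.
  by rewrite ler_ln ?posrE ?invr_gt0 ?divr_gt0.
have := ler_wpM2l (ltW ny) h; apply: le_trans.
by rewrite n2 mulrN -expr2 lerN2 lerDr.
Qed.

(** The difference quotients of [s |-> |y| r^s], with [r = companion y / |y|],
    lie between its derivative at 0 and its increment on [0, 1]; the bound is
    therefore uniform in [s], and it is locally bounded in [y]. *)
Lemma norm_expR_quotient_le y (s : R) : y != 0 -> 0 < s <= 1 ->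
  `|y| * `|(expR (s * log_ratio y) - 1) / s| <= companion y + 1 + y ^+ 2.
Proof.
move=> y0 /andP[s0 s1]; have ny : 0 < `|y| by rewrite normr_gt0.
have c0 := companion_gt0 y y0; have yy := sqr_ge0 y.
set q := log_ratio y.
have lb := @le_expR_quotient R s q s0.
have ub : (expR (s * q) - 1) / s <= expR q - 1.
  have := @expR_chord R s q; rewrite (ltW s0) s1 => /(_ isT) h.
  by rewrite ler_pdivrMr//; lra.
rewrite -[X in X * _]normr_id -normrM ler_norml; apply/andP; split.
  have := ler_wpM2l (ltW ny) lb; have := log_ratio_ge y y0; rewrite -/q; lra.
have := ler_wpM2l (ltW ny) ub; rewrite mulrBr expR_log_ratio// mulr1; lra.
Qed.

Lemma norm_log_ratio_le y : y != 0 ->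
  `|y| * `|log_ratio y| <= companion y + 1 + y ^+ 2.
Proof.
move=> y0; have ny : 0 < `|y| by rewrite normr_gt0.
have c0 := companion_gt0 y y0; have yy := sqr_ge0 y.
have lb := log_ratio_ge y y0.
have ub := ler_wpM2l (ltW ny) (expR_ge1Dx (log_ratio y)).
rewrite expR_log_ratio// mulrDr mulr1 in ub.
by rewrite -[X in X * _]normr_id -normrM ler_norml; apply/andP; split; lra.
Qed.

Lemma sqr_log_ratio_le y : 0 < `|y| <= 1 -> `|y ^+ 2 * log_ratio y| <= 2 * `|y|.
Proof.
move=> /andP[ny y1]; have y0 : y != 0 by rewrite -normr_gt0.
have n2 : y ^+ 2 = `|y| * `|y| by rewrite -expr2 real_normK ?num_real.
have c1 : companion y <= 1 by rewrite -companion1 companion_le// normr1.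
have lb := log_ratio_ge y y0.
have ub : `|y| * log_ratio y <= 1.
  rewrite (le_trans _ c1)// -[leRHS]expR_log_ratio// ler_wpM2l//.
  by rewrite (le_trans _ (expR_ge1Dx _))// lerDr.
have yy : y ^+ 2 <= 1 by rewrite n2 mulr_ile1.
rewrite n2 -mulrA normrM normr_id mulrC ler_wpM2r// ler_norml; apply/andP; split; lra.
Qed.

(** The limit at the origin is 0, which is also the value there of the
    right-hand side: the extension needs no case distinction. *)
Lemma extend0_log_ratio (n y : R) : 0 < n ->
  extend0 (fun y => y ^+ 2 * ln (inv_nneg phi (phi 1 * (y / n) ^+ 2) / `|y / n|)) y
    = y ^+ 2 * log_ratio (y / n).
Proof.
move=> n0; rewrite /extend0; case: eqVneq => [->|//].
rewrite expr0n mul0r; apply/cvg_lim => //.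
apply/cvgrPdist_le => e e0; near=> z.
have z0 : z != 0 by near: z; exact: nbhs_dnbhs_neq.
have zn : `|z| <= n.
  near: z; apply: dnbhs0_le => //.
have ze : `|z| <= e / (2 * n).
  by near: z; apply: dnbhs0_le; rewrite divr_gt0// mulr_gt0.
rewrite sub0r normrN -/(companion _) -/(log_ratio _).
have -> : z ^+ 2 * log_ratio (z / n) = n ^+ 2 * ((z / n) ^+ 2 * log_ratio (z / n)).
  by rewrite mulrA -exprMn mulrCA divff ?mulr1// gt_eqF.
rewrite normrM ger0_norm ?sqr_ge0//.
have nz : `|z / n| = `|z| / n by rewrite normrM (ger0_norm (_ : 0 <= n^-1))// invr_ge0 ltW.
have h : `|(z / n) ^+ 2 * log_ratio (z / n)| <= 2 * `|z / n|.
  apply: sqr_log_ratio_le; rewrite nz divr_gt0 ?normr_gt0//=.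
  by rewrite ler_pdivrMr// mul1r.
rewrite (le_trans (ler_wpM2l (sqr_ge0 n) h))// nz.
have -> : n ^+ 2 * (2 * (`|z| / n)) = `|z| * (2 * n).
  by field; rewrite gt_eqF.
by rewrite -ler_pdivlMr// mulr_gt0.
Unshelve. all: by end_near. Qed.

End young.

Arguments companion {R} phi y.
Arguments log_ratio {R} phi y.

Lemma young_inequality (R : realType) (tau taus : R -> R) (x y : R) :
  young_pair tau taus -> x * y <= tau x + taus y.
Proof.
move=> htau; rewrite -lerBlDl -lee_fin (young_pair_dual htau y).
by apply: ereal_sup_ubound; exists x.
Qed.

(** * Duality between the gauge norm and the complementary function *)

Section orlicz_duality.
Context {d : measure_display} {T : measurableType d} {R : realType}.
Variable mu : probability T R.
Variables tau taus : R -> R.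
Hypothesis htau : young_pair tau taus.

(** Hoelder's inequality for the gauge, with constant 1: integrate Young's
    inequality and use [tau 1 + taus 1 = 1]. *)
Lemma inner_le_gauge (h g : T -> R) :
  h \in Lfun mu 2%:E -> g \in Lfun mu 2%:E ->
  (\int[mu]_x (taus (g x))%:E <= (taus 1)%:E)%E ->
  ((L2inner mu h g)%:E <= gauge mu tau h)%E.
Proof.
move=> hL gL gtaus; apply/ereal_infP => _ [k [k0 hk] <-]; rewrite lee_fin.
have yl := young_pair_l htau; have yr := young_pair_r htau.
have integrable_young (phi : R -> R) (F : T -> R) (c : R) :
    young_function phi -> measurable_fun setT F ->
    (\int[mu]_x (phi (F x))%:E <= c%:E)%E ->
    mu.-integrable setT (EFin \o (fun x => phi (F x))) /\
    \int[mu]_x (phi (F x)) <= c.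
  move=> hphi mF leF.
  have mphi : measurable_fun setT (fun x => phi (F x)).
    apply: (@measurableT_comp _ _ _ _ _ _ phi) => //.
    by apply: continuous_measurable_fun; exact: young_continuous hphi.
  have iF : mu.-integrable setT (EFin \o (fun x => phi (F x))).
    apply/integrableP; split; first exact/measurable_EFinP.
    apply: (le_lt_trans _ (ltry c)); apply: (le_trans _ leF).
    apply: ge0_le_integral => //.
    - by apply/measurable_EFinP; apply: measurableT_comp.
    - exact/measurable_EFinP.
    - by move=> x _; rewrite /= ger0_norm// young_ge0.
  split=> //; rewrite -lee_fin /Rintegral fineK//.
  exact: integrable_fin_num.
have mh : measurable_fun setT (fun x => h x / k).
  by apply: measurable_funM => //; exact: L2_measurable hL.
have [ih lh] := integrable_young _ _ _ yl mh hk.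
have [ig lg] := integrable_young _ _ _ yr (L2_measurable _ _ gL) gtaus.
have scaled : L2inner mu h g = k * L2inner mu (fun x => h x / k) g.
  rewrite !(innerC mu _ g) -inner_scaler//.
    by congr L2inner; apply/funext => x; rewrite mulrCA divff ?mulr1// gt_eqF.
  by under eq_fun do rewrite mulrC; exact: L2_scale.
rewrite scaled -[leRHS]mulr1 ler_wpM2l ?(ltW k0)//.
rewrite -(young_pair_normalized htau) (le_trans _ (lerD lh lg))//.
rewrite -RintegralD//; apply: le_Rintegral_ae => //.
- apply: integrable_mul => //.
  by under eq_fun do rewrite mulrC; exact: L2_scale.
- exact: (integrableD _ ih ig).
- by apply: aeW => x; exact: young_inequality.
Qed.

Lemma gauge_cst1 (h : T -> R) : h \in Lfun mu 2%:E ->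
  {ae mu, forall x, h x = 1} -> (1%:E <= gauge mu tau h)%E.
Proof.
move=> hL h1; apply/ereal_infP => _ [k [k0 hk] <-]; rewrite lee_fin.
have yl := young_pair_l htau.
have : tau (1 / k) <= tau 1.
  rewrite -lee_fin; apply: le_trans hk; rewrite le_eqVlt; apply/orP; left; apply/eqP.
  have -> : (tau (1 / k))%:E = (\int[mu]_x (tau (1 / k))%:E)%E.
    by rewrite integral_cst// [X in (_ * X)%E](@probability_setT _ _ _ mu) mule1.
  apply: ae_eq_integral => //.
    apply/measurable_EFinP; apply: measurableT_comp.
      by apply: continuous_measurable_fun; exact: young_continuous yl.
    by apply: measurable_funM => //; exact: L2_measurable hL.
  by apply: filterS h1 => x -> _.
rewrite !leNgt; apply: contra => k1; apply: (young_lt yl) => //.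
by rewrite ltr_pdivlMr// mul1r.
Qed.

End orlicz_duality.

(** * Dyadic interpolation and its derivative at the origin *)

Section interpolation.
Context {d : measure_display} {T : measurableType d} {R : realType}.
Variable mu : probability T R.
Variable P : R -> (T -> R) -> T -> R.
Variables tau taus : R -> R.
Variables (t0 C M : R) (f g : T -> R).
Hypothesis hP : symmetric_markov_semigroup mu P.
Hypothesis htau : young_pair tau taus.
Hypothesis t0_gt0 : 0 < t0.
Hypothesis C_ge1 : 1 <= C.
Hypothesis gauge_le : forall h, h \in Lfun mu 2%:E -> L2norm mu h <= 1 ->
  (gauge mu tau (P t0 h) <= C%:E)%E.
Hypothesis f_bounded : forall x, `|f x| <= M.
Hypothesis f_gen : is_generator mu P f g.
Hypothesis f_neq0 : L2norm mu f != 0.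

Local Notation L2 := (Lfun mu 2%:E).
Local Notation inner := (L2inner mu).
Let n := L2norm mu f.
Let c := ln C.
Let yr : young_function taus. Proof. exact: young_pair_r htau. Qed.
(* [r = exp q] is the ratio of the companion to [|f| / n]; [u s = |f| r^s]
   joins [|f|] to [n] times the companion, [v s] carries the sign of [f], and
   [w s] is the difference quotient of [v] between 0 and [s]. *)
Let q x := log_ratio taus (f x / n).
Let w (s : R) x := f x * ((expR (s * q x) - 1) / s).
Let v (s : R) x := f x * expR (s * q x).
Let u (s : R) x := `|f x| * expR (s * q x).
Let K := n * (companion taus (M / n) + 1 + (M / n) ^+ 2).

Let fL : f \in L2. Proof. by case: f_gen. Qed.
Let gL : g \in L2. Proof. by case: f_gen. Qed.
Let mf : measurable_fun setT f. Proof. exact: L2_measurable fL. Qed.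
Let n_gt0 : 0 < n. Proof. by rewrite lt_neqAle eq_sym f_neq0 L2norm_ge0. Qed.
Let PL2 t h : 0 <= t -> h \in L2 -> P t h \in L2.
Proof. exact: semigroup_Lfun hP _ _. Qed.

Let mz : measurable_fun setT (fun x => f x / n).
Proof. by apply: measurable_funM. Qed.

Let mq : measurable_fun setT q.
Proof. by apply: measurableT_comp mz; exact: measurable_log_ratio. Qed.

Let z_le x : `|f x / n| <= `|M / n|.
Proof.
rewrite !normrM; apply: ler_wpM2r => //.
exact: le_trans (f_bounded x) (ler_norm _).
Qed.

Let f_z x : f x = n * (f x / n).
Proof. by rewrite mulrCA divff ?mulr1// gt_eqF. Qed.

Let z_neq0 x : f x != 0 -> f x / n != 0.
Proof. by move=> fx; rewrite mulf_neq0// invr_eq0 gt_eqF. Qed.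

Let K_ge0 : 0 <= K.
Proof.
rewrite mulr_ge0 ?(ltW n_gt0)// addr_ge0 ?sqr_ge0//.
by rewrite addr_ge0// companion_ge0.
Qed.

Let scaled_bound x (r : R) :
  (f x / n != 0 -> `|f x / n| * `|r| <=
    companion taus (f x / n) + 1 + (f x / n) ^+ 2) ->
  `|f x * r| <= K.
Proof.
have [->|fx] := eqVneq (f x) 0 => h; first by rewrite mul0r normr0.
have -> : f x * r = n * (f x / n * r) by rewrite mulrA -f_z.
rewrite normrM gtr0_norm// ler_pM2l// normrM.
rewrite (le_trans (h (z_neq0 x fx)))// lerD//; last first.
  by rewrite -real_normK ?num_real// -[leRHS]real_normK ?num_real// lerXn2r.
by rewrite lerD2r companion_le.
Qed.

Let w_bounded s x : 0 < s <= 1 -> `|w s x| <= K.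
Proof.
by move=> s01; apply: scaled_bound => z0; exact: norm_expR_quotient_le.
Qed.

Let wL s : 0 < s <= 1 -> w s \in L2.
Proof.
move=> s01; apply: (L2_bounded mu _ K) => [|x]; last exact: w_bounded.
apply: measurable_funM => //; apply: measurable_funM => //.
apply: measurable_funB => //; apply: measurableT_comp => //.
exact: measurable_funM.
Qed.

Let vE s : 0 < s <= 1 -> v s = fun x => s * w s x + f x.
Proof.
move=> /andP[s0 _]; apply/funext => x; rewrite /v /w; field.
by rewrite gt_eqF.
Qed.

Let vL s : 0 < s <= 1 -> v s \in L2.
Proof. by move=> s01; rewrite vE// L2_lin// wL. Qed.

Let uE s : u s = fun x => `|v s x|.
Proof.
by apply/funext => x; rewrite /u /v normrM [X in _ = _ * X]ger0_norm ?expR_ge0.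
Qed.

Let uL s : 0 < s <= 1 -> u s \in L2.
Proof. by move=> s01; rewrite uE; exact/L2_abs/vL. Qed.

Let u_ge0 s x : 0 <= u s x.
Proof. by rewrite mulr_ge0 ?expR_ge0. Qed.

(** [u (s / 2)] is the geometric mean of [|f|] and [u s]. *)
Let u_half s t : 0 < s <= 1 -> 0 <= t ->
  inner (u (s / 2)) (P t (u (s / 2))) <= inner (fun x => `|f x|) (P t (u s)).
Proof.
move=> /andP[s0 s1] t_ge0.
have s2 : 0 < s / 2 <= 1 by apply/andP; split; lra.
apply: (semigroup_geometric_mean mu P hP) => //.
- exact: L2_abs.
- by apply: uL; rewrite s0.
- exact: uL.
- move=> x; rewrite /u exprMn -expRM_natl.
  have -> : 2%:R * (s / 2 * q x) = s * q x by field.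
  by ring.
Qed.

Let u_one x : u 1 x = n * companion taus (f x / n).
Proof.
rewrite /u mul1r; have [->|fx] := eqVneq (f x) 0.
  rewrite normr0 !mul0r; apply/esym/eqP; rewrite mulf_eq0 gt_eqF//=.
  rewrite eq_le companion_ge0// andbT /companion expr0n/= mulr0.
  by rewrite inv_nneg_le// (young0 yr).
rewrite -(expR_log_ratio yr _ (z_neq0 x fx)) mulrA; congr (_ * _).
by rewrite {1}f_z normrM (gtr0_norm n_gt0).
Qed.

(** The only place where the Orlicz bound enters: by symmetry the pairing is
    [n^2] times that of [P t0 (|f| / n)] with the companion function. *)
Let base_case : inner (fun x => `|f x|) (P t0 (u 1)) <= n ^+ 2 * C.
Proof.
have t0_ge0 := ltW t0_gt0; have aL : (fun x => `|f x|) \in L2 by exact: L2_abs.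
pose G x := companion taus (f x / n).
have u1E : u 1 = fun x => n * G x by apply/funext => x; exact: u_one.
have GL : G \in L2.
  have -> : G = fun x => n^-1 * u 1 x.
    by apply/funext => x; rewrite u1E mulrA mulVf ?mul1r// gt_eqF.
  by apply/L2_scale/uL; rewrite ltr01 lexx.
pose h x := n^-1 * `|f x|.
have hL : h \in L2 by exact: L2_scale.
have h1 : L2norm mu h <= 1.
  rewrite L2norm_scale// L2norm_abs// ger0_norm ?invr_ge0 ?(ltW n_gt0)//.
  by rewrite -/n mulVf// gt_eqF.
have absE : (fun x => `|f x|) = fun x => n * h x.
  by apply/funext => x; rewrite /h mulrA divff ?mul1r// gt_eqF.
have -> : inner (fun x => `|f x|) (P t0 (u 1)) = n ^+ 2 * inner (P t0 h) G.
  rewrite /L2inner (semigroup_symmetric hP)//; last by apply: uL; rewrite ltr01 lexx.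
  rewrite -/(L2inner mu _ _) u1E inner_scaler// ?PL2// innerC absE.
  rewrite (inner_ae_eqr mu G _ (fun x => n * P t0 h x)) ?PL2 ?L2_scale ?PL2//.
  - by rewrite inner_scaler ?PL2// mulrA -expr2 innerC.
  - exact: semigroup_scale.
rewrite ler_pM2l ?exprn_gt0// -lee_fin.
apply: le_trans (gauge_le h hL h1); apply: (inner_le_gauge mu tau taus htau).
- exact: PL2.
- exact: GL.
under eq_integral do rewrite young_companion//.
have iz : mu.-integrable setT (EFin \o (fun x => (f x / n) ^+ 2)).
  apply: Lfun2_integrable_sqr; have := L2_scale mu n^-1 f fL.
  by under eq_fun do rewrite mulrC.
under eq_integral do rewrite EFinM.
rewrite integralZl// -[X in (_ * X <= _)%E]fineK; last exact: integrable_fin_num.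
rewrite -EFinM lee_fin -[leRHS]mulr1 ler_wpM2l ?young_ge0//.
rewrite -/(Rintegral mu setT (fun x => (f x / n) ^+ 2)).
under eq_Rintegral do rewrite expr2 mulrACA.
rewrite RintegralZr//; last exact: integrable_mul.
by rewrite -/(L2inner mu f f) inner_diag// -/n expr2 mulrACA divff ?mulr1// gt_eqF.
Qed.

Let half (k : nat) : R := 2^-1 ^+ k.

Let half_gt0 k : 0 < half k. Proof. by rewrite exprn_gt0. Qed.
Let half_le1 k : half k <= 1.
Proof. by rewrite exprn_ile1// invf_le1// ler1n. Qed.
Let halfS k : half k.+1 = half k / 2. Proof. by rewrite /half exprSr. Qed.

Let half_itv k : 0 < half k <= 1. Proof. by rewrite half_gt0 half_le1. Qed.

Let th_ge0 k : 0 <= t0 * half k.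
Proof. by rewrite mulr_ge0 ?ltW. Qed.

(** At each step the geometric mean and the Cauchy-Schwarz inequality give
    [A (k+1) <= n * sqrt (A k)] for the left-hand side [A k], since
    [A k] is the square of the norm of [P (t0 * half k.+1) (u (half k.+1))]. *)
Let dyadic_interpolation k :
  inner (u (half k.+1)) (P (t0 * half k) (u (half k.+1)))
    <= n ^+ 2 * expR (half k * c).
Proof.
elim: k => [|k IH].
  have e1 : half 0 = 1 by rewrite /half expr0.
  rewrite halfS e1 mulr1 [X in expR X]mul1r lnK; last first.
    by rewrite posrE (lt_le_trans ltr01).
  apply: le_trans base_case; apply: u_half; rewrite ?ltr01 ?lexx//.
  exact: ltW.
rewrite [in leLHS](halfS k.+1).
have sL := uL _ (half_itv k.+1).
apply: le_trans (u_half _ _ (half_itv k.+1) (th_ge0 k.+1)) _.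
apply: le_trans (ler_norm _) _.
apply: le_trans (inner_Cauchy_Schwarz mu _ _ (L2_abs mu f fL) (PL2 _ _ (th_ge0 k.+1) sL)) _.
rewrite L2norm_abs// -/n expr2 -mulrA ler_pM2l//.
rewrite -(@ler_pXn2r _ 2) ?nnegrE ?L2norm_ge0 ?mulr_ge0 ?expR_ge0 ?(ltW n_gt0)//.
have -> : t0 * half k.+1 = t0 * half k / 2 by rewrite halfS mulrA.
rewrite -semigroup_inner_square// exprMn -expRM_natl.
have -> : 2%:R * (half k.+1 * c) = half k * c by rewrite halfS; field.
exact: IH.
Qed.

Let E := \int[mu]_x (f x ^+ 2 * q x).

Let fqL : (fun x => f x * q x) \in L2.
Proof.
apply: (L2_bounded mu _ K); first exact: measurable_funM.
by move=> x; apply: scaled_bound => z0; exact: norm_log_ratio_le.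
Qed.

Let E_inner : E = inner (fun x => f x * q x) f.
Proof. by apply: eq_Rintegral => x _; rewrite [RHS]mulrAC -expr2. Qed.

Let entropy_le_inner s : 0 < s <= 1 -> E <= inner (w s) f.
Proof.
move=> s01; rewrite E_inner; apply: le_inner => //; first exact: wL.
apply: aeW => x; rewrite /w [leLHS]mulrAC [leRHS]mulrAC -!expr2 ler_wpM2l ?sqr_ge0//.
by apply: le_expR_quotient; case/andP : s01.
Qed.

Let wnorm s : 0 < s <= 1 -> L2norm mu (w s) <= K.
Proof. by move=> s01; apply: L2norm_le_bound => // [|x]; [exact: wL|exact: w_bounded]. Qed.

(** The first term bounds [n^2 (C^(half k) - 1) / half k] and tends to [n^2 c].
    The second and the last one are errors that vanish, by strong continuity of
    the semigroup and by definition of the generator. *)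
Let entropy_le_dyadic k : E <= n ^+ 2 * (c * expR (half k * c))
  + K * L2norm mu (P (t0 * half k) f \- f)
  - t0 * inner f g
  + t0 * (n * L2norm mu (fun x =>
      (t0 * half k)^-1 * (P (t0 * half k) f x - f x) - g x)).
Proof.
set t := t0 * half k; have t_gt0 : 0 < t by rewrite mulr_gt0.
have t_ge0 := ltW t_gt0; have s_itv := half_itv k.+1.
set s := half k.+1 in s_itv *; have s_gt0 : 0 < s by case/andP : s_itv.
have k2 : half k = 2 * s by rewrite /s halfS; field.
have PfL := PL2 t f t_ge0 fL; have wsL := wL s s_itv; have vsL := vL s s_itv.
have dL : (fun x => P t f x - f x) \in L2 by exact: L2_sub.
have upper : inner (v s) (P t (v s)) <= n ^+ 2 * expR (half k * c).
  apply: le_trans (dyadic_interpolation k); rewrite uE.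
  exact: semigroup_inner_abs.
have tangent : 2 * inner (v s) (P t f) - inner f (P t f) <= inner (v s) (P t (v s)).
  exact: semigroup_inner_tangent.
have vw : inner (v s) (P t f) = s * inner (w s) (P t f) + inner f (P t f).
  by rewrite innerC vE// inner_linr// !(innerC mu (P t f)).
have wf : E - K * L2norm mu (P t f \- f) <= inner (w s) (P t f).
  have := inner_subr mu (w s) (P t f) f wsL PfL fL.
  have := inner_Cauchy_Schwarz mu _ _ wsL dL; rewrite ler_norml => /andP[+ _].
  have := ler_wpM2r (L2norm_ge0 mu (P t f \- f)) (wnorm s s_itv).
  have := entropy_le_inner s s_itv.
  rewrite -[P t f \- f]/(fun x => P t f x - f x).
  lra.
pose D x := t^-1 * (P t f x - f x).
have DL : D \in L2 by exact: L2_scale.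
have fD : t * inner f D = inner f (P t f) - n ^+ 2.
  rewrite inner_scaler// mulrA divff ?gt_eqF// mul1r inner_subr//.
  by rewrite [X in _ - X]inner_diag.
have fg : inner f g - n * L2norm mu (fun x => D x - g x) <= inner f D.
  have := inner_Cauchy_Schwarz mu _ _ fL (L2_sub mu D g DL gL).
  by rewrite ler_norml => /andP[+ _]; rewrite inner_subr// -/n; lra.
have expo : expR (half k * c) - 1 <= half k * (c * expR (half k * c)).
  set y := half k * c; have := expR_ge1Dx (- y).
  rewrite expRN mulrA -/y -(ler_pM2l (expR_gt0 y)) divff ?gt_eqF ?expR_gt0//.
  by lra.
have main : 2 * s * inner (w s) (P t f) + t * inner f D <= n ^+ 2 * (expR (half k * c) - 1).
  by rewrite fD; lra.
rewrite -k2 in main.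
have main2 : half k * (inner (w s) (P t f) + t0 * inner f D)
    <= half k * (n ^+ 2 * (c * expR (half k * c))).
  rewrite mulrDr mulrA [half k * t0]mulrC -/t (le_trans main)//.
  rewrite [leRHS]mulrCA ler_wpM2l// sqr_ge0//.
rewrite ler_pM2l// in main2.
have := ler_wpM2l (ltW t0_gt0) fg; rewrite mulrBr -/D.
lra.
Qed.

Let entropy_le_generator : E <= n ^+ 2 * c - t0 * inner f g.
Proof.
have half_cvg : half @ \oo --> (0 : R).
  by apply: cvg_expr; rewrite gtr0_norm ?invr_gt0// invf_lt1// ltr1n.
have t_cvg : (fun k => t0 * half k) @ \oo --> (0 : R).
  by rewrite -(mulr0 t0); exact: cvgMl_tmp.
have t_pos k : t0 * half k > 0 by rewrite mulr_gt0.
have [_ _ gen_cvg] := f_gen.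
have L1 := (cvg_at_rightP _ _ _).1 (semigroup_continuous hP fL) _ (conj t_pos t_cvg).
have L2 := (cvg_at_rightP _ _ _).1 gen_cvg _ (conj t_pos t_cvg).
have L3 : (fun k => expR (half k * c)) @ \oo --> (1 : R).
  rewrite -(@expR0 R) -(mul0r c); apply: (cvg_comp _ expR); last exact: continuous_expR.
  by apply: cvgM => //; exact: cvg_cst.
have lim : (fun k => n ^+ 2 * (c * expR (half k * c))
  + K * L2norm mu (P (t0 * half k) f \- f)
  - t0 * inner f g
  + t0 * (n * L2norm mu (fun x =>
      (t0 * half k)^-1 * (P (t0 * half k) f x - f x) - g x))) @ \oo -->
  n ^+ 2 * (c * 1) + K * 0 - t0 * inner f g + t0 * (n * 0).
  apply: cvgD; last by do 2 (apply: cvgMl_tmp).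
  apply: cvgB; last exact: cvg_cst.
  by apply: cvgD; [do 2 (apply: cvgMl_tmp)|apply: cvgMl_tmp].
rewrite mulr1 !mulr0 !addr0 in lim.
by apply: (cvgr_to_ge lim); apply: nearW => k; exact: entropy_le_dyadic.
Qed.

Let orlicz_entropy_integral : orlicz_entropy mu taus f = E%:E.
Proof.
rewrite /orlicz_entropy /E /Rintegral fineK.
  by apply: eq_integral => x _; rewrite extend0_log_ratio.
apply: integrable_fin_num => //.
have := integrable_mul mu _ _ fqL fL.
by under [EFin \o _]eq_fun do rewrite /= mulrAC -expr2.
Qed.

Lemma orlicz_entropy_le_generator :
  (orlicz_entropy mu taus f <=
    (L2norm mu f ^+ 2 * ln C - t0 * L2inner mu f g)%:E)%E.
Proof. by rewrite orlicz_entropy_integral lee_fin entropy_le_generator. Qed.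

End interpolation.

(** Test the operator norm on the constant function 1, which [P t0] fixes and
    whose gauge is 1. *)
Lemma orlicz_opnorm_ge1 (d : measure_display) (T : measurableType d)
    (R : realType) (mu : probability T R) (P : R -> (T -> R) -> T -> R)
    (tau taus : R -> R) (t0 : R) :
  symmetric_markov_semigroup mu P -> young_pair tau taus -> 0 <= t0 ->
  (1%:E <= orlicz_opnorm mu P tau t0)%E.
Proof.
move=> hP htau t0_ge0; have oneL := L2_cst mu 1.
apply: (@le_trans _ _ (gauge mu tau (P t0 (cst 1)))).
  apply: (gauge_cst1 mu tau taus htau).
    exact: (semigroup_Lfun hP t0_ge0 oneL).
  exact: (semigroup_one hP t0_ge0).
apply: ereal_sup_ubound; exists (cst 1) => //; split=> //.
by rewrite L2norm_cst1.
Qed.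

Theorem theorem4 (d : measure_display) (T : measurableType d) (R : realType)
    (mu : probability T R) (P : R -> (T -> R) -> T -> R) (D : set (T -> R))
    (tau taus : R -> R) (t0 : R)
    (hP : symmetric_markov_semigroup mu P)
    (hD : core_algebra mu P D)
    (hL : diffusion mu P D)
    (htau : young_pair tau taus)
    (ht0 : 0 < t0)
    (hext : cvg ((fun y : R =>
       y ^+ 2 * ln (inv_nneg taus (y ^+ 2 * taus 1) / `|y|)) @ 0^')) :
  (orlicz_hyperbounded mu P tau t0 ->
   forall f, D f -> L2norm mu f != 0 ->
   (orlicz_entropy mu taus f <=
     (t0 / 2 * dirichlet mu P f f
      + ln (fine (orlicz_opnorm mu P tau t0)) * L2norm mu f ^+ 2)%:E)%E) /\
  (orlicz_hypercontractive mu P tau t0 ->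
   forall f, D f -> L2norm mu f != 0 ->
   (orlicz_entropy mu taus f <= (t0 / 2 * dirichlet mu P f f)%:E)%E).
Proof.
have bound (C : R) (f : T -> R) : 1 <= C ->
    (forall h, h \in Lfun mu 2%:E -> L2norm mu h <= 1 ->
      (gauge mu tau (P t0 h) <= C%:E)%E) ->
    D f -> L2norm mu f != 0 ->
    (orlicz_entropy mu taus f <=
      (t0 / 2 * dirichlet mu P f f + ln C * L2norm mu f ^+ 2)%:E)%E.
  move=> C1 gauge_le Df f0; have [M fM] := core_bounded hD Df.
  have f_gen : is_generator mu P f (gen mu P f).
    by have [g fg] := core_dom hD Df; apply: xgetPex; exists g.
  have := orlicz_entropy_le_generator mu P tau taus t0 C M f (gen mu P f)
    hP htau ht0 C1 gauge_le fM f_gen f0.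
  suff -> : t0 / 2 * dirichlet mu P f f + ln C * L2norm mu f ^+ 2 =
    L2norm mu f ^+ 2 * ln C - t0 * L2inner mu f (gen mu P f) by [].
  by rewrite /dirichlet -/(L2inner mu f (gen mu P f)); field.
split=> [[_ opnorm_fin] f|contr f] Df f0.
  have opnorm_ge1 := orlicz_opnorm_ge1 _ _ _ mu P tau taus t0 hP htau (ltW ht0).
  have opE : (fine (orlicz_opnorm mu P tau t0))%:E = orlicz_opnorm mu P tau t0.
    by rewrite fineK// ge0_fin_numE// (le_trans _ opnorm_ge1).
  apply: bound => // [|h hL2 h1]; first by rewrite -lee_fin opE.
  by rewrite opE; apply: ereal_sup_ubound; exists h.
have := bound 1 f (lexx 1); rewrite ln1 mul0r addr0; apply=> // h hL2 h1.
by have [_ /le_trans->//] := contr h hL2; rewrite lee_fin.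
Qed.
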